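(* Let $F$ be an admissible functional for $V$ and let $A \subseteq V$. Then $\widetilde{F}[\overline{A}] = \widetilde{F}[A]$, where $\overline{A}$ is the Zariski-closure of $A$.
   Context: Let $V$ be a finite-dimensional vector space over an arbitrary field $\mathbb{F}$. An admissible functional $F$ is a family of functions $F_n\colon V^{\otimes n}\to\mathbb{R}_{\geq0}$ ($n\geq1$) that is subadditive ($F_n(T+S)\leq F_n(T)+F_n(S)$), submultiplicative ($F_{n+n'}(T\otimes S)\leq F_n(T)F_{n'}(S)$), invariant under permuting tensor factors $T_1\otimes\cdots\otimes T_\ell$ with $T_j\in V^{\otimes n_j}$, invariant under nonzero scaling, and with $F_1$ bounded on $V$. Its regularization is $\widetilde{F}(T)=\lim_{n\to\infty}F_n(T^{\otimes n})^{1/n}$ for $T\in V$, and for $A\subseteq V$, $\widetilde{F}[A]=\sup_{T\in A}\widetilde{F}(T)$. The Zariski-closure of $A$ is the set of $T\in V$ such that every polynomial function on $V$ vanishing on $A$ vanishes at $T$. *)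

(* Defs.v *)
From HB Require Import structures.
From mathcomp Require Import all_boot all_order all_algebra all_fingroup.
From mathcomp Require Import all_classical all_reals all_analysis.
From mathcomp.multinomials Require mpoly.

Set Implicit Arguments.
Unset Strict Implicit.
Unset Printing Implicit Defensive.

Import Order.TTheory GRing.Theory Num.Theory.
Import numFieldNormedType.Exports.

Local Open Scope classical_set_scope.
Local Open Scope ring_scope.

(* The n-th tensor power of V, in coordinates: an element of V^{(x)n} is the
   array of its coefficients on the basis (b_{i_1} (x) ... (x) b_{i_n}), where
   (b_i) is the basis [vbasis {:V}] of V.  [tpow_universal] below shows that
   this is the tensor power in the sense of the universal property. *)
Definition tpow (K : fieldType) (V : vectType K) (n : nat) :=
  {ffun {ffun 'I_n -> 'I_(\dim {:V})} -> K^o}.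

Section TensorPower.
Variables (K : fieldType) (V : vectType K).

Definition vcoord (v : V) (i : 'I_(\dim {:V})) : K :=
  coord (vbasis {:V}) i v.

Definition tpure n (v : 'I_n -> V) : tpow V n :=
  [ffun f : {ffun 'I_n -> 'I_(\dim {:V})} => \prod_(i < n) vcoord (v i) (f i)].

Definition tmul m n (S : tpow V m) (T : tpow V n) : tpow V (m + n) :=
  [ffun f : {ffun 'I_(m + n) -> 'I_(\dim {:V})} =>
     S [ffun i => f (lshift n i)] * T [ffun j => f (rshift m j)]].

Definition texp (v : V) (n : nat) : tpow V n := tpure (fun _ : 'I_n => v).

(* Tensors of arbitrary degree, packed with their degree: this makes iterated
   products associative without transports between V^{(x)(m+n)+p} and
   V^{(x)m+(n+p)}. *)
Definition htensor := {n : nat & tpow V n}.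

Definition hone : htensor := Tagged (tpow V) ([ffun=> 1] : tpow V 0).

Definition hmul (S T : htensor) : htensor :=
  Tagged (tpow V) (tmul (tagged S) (tagged T)).

Definition tensor_prod l (n : 'I_l -> nat) (T : forall j, tpow V (n j)) :
    htensor :=
  \big[hmul/hone]_(j < l) Tagged (tpow V) (T j).

End TensorPower.

(* The family F is indexed by all n : nat; as only the F_n with n >= 1 are
   part of the data, F 0 is left unconstrained and never used. *)
Record admissible (R : realType) (K : fieldType) (V : vectType K)
    (F : forall n, tpow V n -> R) : Prop := Admissible {
  adm_ge0 : forall n (T : tpow V n), (0 < n)%N -> 0 <= F n T;
  adm_subadd : forall n (T S : tpow V n), (0 < n)%N ->
    F n (T + S) <= F n T + F n S;
  adm_submul : forall m n (T : tpow V m) (S : tpow V n),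
    (0 < m)%N -> (0 < n)%N -> F (m + n)%N (tmul T S) <= F m T * F n S;
  adm_perm : forall l (n : 'I_l -> nat) (T : forall j, tpow V (n j))
      (s : 'S_l), (0 < l)%N -> (forall j, (0 < n j)%N) ->
    let P := tensor_prod T in
    let Ps := tensor_prod (fun j => T (s j)) in
    F (tag Ps) (tagged Ps) = F (tag P) (tagged P);
  adm_scale : forall n (a : K) (T : tpow V n), (0 < n)%N -> a != 0 ->
    F n (a *: T) = F n T;
  adm_bounded : exists C : R, forall v : V, F 1%N (texp v 1) <= C
}.

(* For an admissible F the limit exists by Fekete's lemma (submultiplicativity)
   and is real; the term n = 0 of the sequence plays no role. *)
Definition regularization (R : realType) (K : fieldType) (V : vectType K)
    (F : forall n, tpow V n -> R) (v : V) : R :=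
  lim ((fun n : nat => F n (texp v n) `^ (n%:R^-1)) @ \oo).

Definition regularization_sup (R : realType) (K : fieldType) (V : vectType K)
    (F : forall n, tpow V n -> R) (A : set V) : \bar R :=
  ereal_sup [set (regularization F v)%:E | v in A].

Definition zariski_closure (K : fieldType) (V : vectType K) (A : set V) :
    set V :=
  [set v | forall p : mpoly.mpoly (\dim {:V}) K,
     (forall w, A w -> mpoly.meval (vcoord w) p = 0) ->
     mpoly.meval (vcoord v) p = 0].

Section Universal.
Variables (K : fieldType) (V : vectType K) (n : nat).
Local Notation d := (\dim {:V}).

Definition multilinear (W : lmodType K) (f : ('I_n -> V) -> W) : Prop :=
  forall (v : 'I_n -> V) (i : 'I_n) (a : K) (x y : V),
    f [eta v with i |-> a *: x + y] =
    a *: f [eta v with i |-> x] + f [eta v with i |-> y].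

Lemma tpure_multilinear : multilinear (@tpure K V n).
Proof.
move=> v i a x y; apply/ffunP => f.
have E z : tpure [eta v with i |-> z] f =
    vcoord z (f i) * \prod_(j < n | j != i) vcoord (v j) (f j).
  rewrite ffunE (bigD1 i) //= eqxx; congr (_ * _).
  by apply: eq_bigr => j /negPf ->.
by rewrite E [RHS]ffunE [X in _ = X + _]ffunE !E /vcoord linearP mulrDl -mulrA.
Qed.

Lemma multilinear_ext (W : lmodType K) (f g : ('I_n -> V) -> W) :
  multilinear f -> multilinear g ->
  (forall h : 'I_n -> 'I_d,
     f (fun i => (vbasis {:V})`_(h i)) = g (fun i => (vbasis {:V})`_(h i))) ->
  f = g.
Proof.
move=> mf mg fg; apply/funext => v.
have H k : (k <= n)%N -> forall v : 'I_n -> V,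
    (forall i : 'I_n, (k <= i)%N -> exists j : 'I_d, v i = (vbasis {:V})`_j) ->
    f v = g v.
  elim: k => [|k IH] kn {}v hv.
    have [h hE] : {h : 'I_n -> 'I_d | forall i, v i = (vbasis {:V})`_(h i)}.
      exists (fun i => projT1 (cid (hv i isT))) => i.
      exact: projT2 (cid (hv i isT)).
    by have -> : v = (fun i => (vbasis {:V})`_(h i)) by apply/funext.
  pose i0 := Ordinal kn.
  have vE x : x = v i0 -> v = [eta v with i0 |-> x].
    by move=> ->; apply/funext => i /=; case: eqP => // ->.
  have add0 (e : ('I_n -> V) -> W) : multilinear e ->
      e [eta v with i0 |-> 0] = 0.
    move=> me; have := me v i0 (-1) 0 0.
    by rewrite scaler0 addr0 scaleN1r addNr.
  have lin (e : ('I_n -> V) -> W) : multilinear e -> e v =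
      \sum_(j < d) vcoord (v i0) j *:
        e [eta v with i0 |-> (vbasis {:V})`_j].
    move=> me; rewrite {1}(vE _ (esym (coord_vbasis (memvf (v i0))))).
    rewrite /vcoord; elim/big_rec2: _ => [|j y1 y2 _ <-]; first exact: add0.
    by rewrite me.
  rewrite (lin _ mf) (lin _ mg); apply: eq_bigr => j _; congr (_ *: _).
  apply: IH (ltnW kn) _ _ => i ki /=; case: eqP => [_|ne]; first by exists j.
  apply: hv; rewrite ltn_neqAle ki andbT; apply/eqP => kE.
  by apply: ne; apply: val_inj.
by apply: (H n) => // i; rewrite leqNgt ltn_ord.
Qed.

Lemma tpure_vbasis (h : 'I_n -> 'I_d) (f : {ffun 'I_n -> 'I_d}) :
  tpure (fun i => (vbasis {:V})`_(h i)) f = (f == finfun h)%:R.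
Proof.
rewrite ffunE; under eq_bigr => i _ do
  rewrite /vcoord coord_free ?(basis_free (vbasisP _)) //.
case: eqP => [->|ne].
  by rewrite big1 // => i _; rewrite ffunE eqxx.
have [i hi] : exists i, f i != h i.
  apply/not_existsP => e; apply: ne; apply/ffunP => i; rewrite ffunE.
  by apply/eqP; apply: contra_notT (e i).
by rewrite (bigD1 i) //= eq_sym -val_eqE /= in hi *; rewrite (negPf hi) mul0r.
Qed.

Theorem tpow_universal (W : lmodType K) (f : ('I_n -> V) -> W) :
  multilinear f ->
  exists! g : tpow V n -> W, linear g /\ forall v, g (tpure v) = f v.
Proof.
move=> mf.
pose b (h : {ffun 'I_n -> 'I_d}) i := (vbasis {:V})`_(h i).
pose g (T : tpow V n) := \sum_h (T h : K) *: f (b h).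
have lg : linear g.
  move=> a S T; rewrite /g scaler_sumr -big_split; apply: eq_bigr => h _ /=.
  by rewrite !ffunE scalerDl scalerA.
exists g; split.
  split=> //; apply/(fun H v => congr1 (@^~ v) H).
  apply: multilinear_ext => // [v i a x y|h].
    by rewrite tpure_multilinear lg.
  rewrite /g (bigD1 (finfun h)) //= tpure_vbasis eqxx scale1r big1 ?addr0.
    by congr f; apply/funext => i; rewrite /b ffunE.
  by move=> h' /negPf ne; rewrite tpure_vbasis ne scale0r.
move=> g' [lg' g'E]; apply/funext => T.
have {2}-> : T = \sum_h (T h : K) *: tpure (b h).
  apply/ffunP => h; rewrite sum_ffunE (bigD1 h) //= big1 ?addr0.
    by rewrite ffunE tpure_vbasis ffunK eqxx [_ *: _]mulr1.
  move=> h' ne; rewrite ffunE tpure_vbasis ffunK eq_sym (negPf ne).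
  by rewrite scaler0.
pose lg'' := GRing.isLinear.Build _ _ _ _ g' lg'.
pose G : {linear tpow V n -> W} := HB.pack g' lg''.
rewrite -[g']/(G : _ -> _) linear_sum; apply: eq_bigr => h _.
by rewrite linearZ [G _]g'E.
Qed.

End Universal.

Lemma tmul_tpure (K : fieldType) (V : vectType K) m n
    (v : 'I_m -> V) (w : 'I_n -> V) :
  tmul (tpure v) (tpure w) =
  tpure (fun k : 'I_(m + n) =>
    match fintype.split k with inl i => v i | inr j => w j end).
Proof.
apply/ffunP => f; rewrite !ffunE big_split_ord /=.
by congr (_ * _); apply: eq_bigr => i _;
  rewrite ffunE ?(unsplitK (inl _)) ?(unsplitK (inr _)).
Qed.

(* Main.v *)
(* If T lies in the Zariski closure of A, then the vector of all monomials of
   T with exponents at most n lies in the span of those of the points of A, so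
   T^{(x)n} is a combination of r <= (n+1)^dim(V) powers S_i^{(x)n}, S_i in A.
   Expanding the k-th tensor power of this identity gives r^k words in the
   finitely many S_i, and permuting factors bounds each of them by a constant
   times y^(nk), for any y above all the regularizations F~(S_i).  Letting k
   grow yields F~(T)^n <= 2 r y^n, and letting n grow F~(T) <= y, because r is
   polynomial in n. *)
Require Import Defs.
From mathcomp Require Import all_boot all_order all_algebra all_fingroup.
From mathcomp Require Import all_classical all_reals all_analysis.
From mathcomp.multinomials Require Import (canonicals) mpoly.
From mathcomp Require Import zify.
Set Implicit Arguments.
Unset Strict Implicit.
Unset Printing Implicit Defensive.
Import Order.TTheory GRing.Theory Num.Theory.
Import numFieldNormedType.Exports.
Local Open Scope classical_set_scope.
Local Open Scope ring_scope.

(** * Growth estimates for real numbers and sequences *)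

Section Growth.
Variable R : realType.
Implicit Types (x y C : R) (a : nat -> R).

Lemma bernoulli_ge x n : 0 <= x -> 1 + n%:R * x <= (1 + x) ^+ n.
Proof.
move=> x0; elim: n => [|n IH]; first by rewrite mul0r addr0 expr0.
rewrite exprS; apply: le_trans (ler_wpM2l _ IH); last by rewrite addr_ge0.
rewrite mulrDl mul1r mulrDr mulr1 -natr1 mulrDl mul1r.
rewrite -addrA lerD2l lerD2l lerDl !mulr_ge0 //.
Qed.

(* With [y ^ (d + 1) = x], Bernoulli's inequality makes [x ^ n] grow at least
   like [(n + 1) ^ (d + 1)] when [1 < x]. *)
Lemma polynomial_growth_le1 x C d : 0 <= x ->
  (forall n, (0 < n)%N -> x ^+ n <= C * n.+1%:R ^+ d) -> x <= 1.
Proof.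
move=> x0 H; rewrite leNgt; apply/negP => x1.
pose y := x `^ d.+1%:R^-1.
have yx : y ^+ d.+1 = x.
  by rewrite -powR_mulrn ?powR_ge0 // -powRrM mulVf ?pnatr_eq0 // powRr1.
have y1 : 1 < y.
  rewrite ltNge; apply/negP => y1; move: x1.
  by rewrite -yx ltNge exprn_ile1 ?powR_ge0.
(* Both [g <= 1] and [g <= y - 1] enter the bound [g * (n + 1) <= 1 + n * (y - 1)]. *)
pose g := Num.min 1 (y - 1).
have g0 : 0 < g by rewrite lt_min ltr01 subr_gt0.
have yn n : g * n.+1%:R <= y ^+ n.
  have -> : y = 1 + (y - 1) by rewrite addrC subrK.
  apply: le_trans (bernoulli_ge n _); last by rewrite subr_ge0 ltW.
  rewrite -natr1 mulrDr mulr1 addrC lerD ?ge_min ?lexx //.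
  by rewrite mulrC ler_wpM2l // ge_min lexx orbT.
have gC n : (0 < n)%N -> n.+1%:R <= C / g ^+ d.+1.
  move=> n0; rewrite ler_pdivlMr ?exprn_gt0 //.
  rewrite -(ler_pM2r (exprn_gt0 d (ltr0Sn R n))).
  apply: le_trans (H n n0); rewrite -yx exprAC.
  have -> : n.+1%:R * g ^+ d.+1 * n.+1%:R ^+ d = (g * n.+1%:R) ^+ d.+1.
    by rewrite exprMn mulrAC -exprS mulrC.
  by rewrite lerXn2r ?nnegrE ?yn // ?exprn_ge0 ?powR_ge0 // mulr_ge0 // ltW.
(* The case [n = 1] shows that [C / g ^+ d.+1] is nonnegative, as the Archimedean bound requires. *)
have := le_trans (ler0n R 2) (gC 1%N isT) => /archi_boundP.
move=> /(le_lt_trans (gC (Num.bound (C / g ^+ d.+1)).+1 isT)).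
by rewrite ltr_nat => /ltnW/ltnW; rewrite ltnn.
Qed.

(** Polynomial factors do not survive [n]-th roots: this is the previous bound for [x / y]. *)
Lemma le_of_exp_le x y C d : 0 <= x -> 0 < y ->
  (forall n, (0 < n)%N -> x ^+ n <= C * n.+1%:R ^+ d * y ^+ n) -> x <= y.
Proof.
move=> x0 y0 H; suff : x / y <= 1 by rewrite ler_pdivrMr // mul1r.
apply: (@polynomial_growth_le1 _ C d); first by rewrite divr_ge0 // ltW.
by move=> n n0; rewrite expr_div_n ler_pdivrMr ?exprn_gt0 // H.
Qed.

(** * Fekete's lemma for submultiplicative sequences *)

Section Fekete.
Variable a : nat -> R.
Hypotheses (a_ge0 : forall n, (0 < n)%N -> 0 <= a n)
  (a_submul : forall m n, (0 < m)%N -> (0 < n)%N -> a (m + n) <= a m * a n).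

Let root n := a n `^ n%:R^-1.
Let L := inf (root @` [set n | (0 < n)%N]).

Lemma root_expn n : (0 < n)%N -> root n ^+ n = a n.
Proof.
move=> n0; rewrite -powR_mulrn ?powR_ge0 // -powRrM mulVf ?pnatr_eq0 -?lt0n //.
by rewrite powRr1 // a_ge0.
Qed.

Lemma root_le n y : (0 < n)%N -> 0 <= y -> (root n <= y) = (a n <= y ^+ n).
Proof.
move=> n0 y0; rewrite -(root_expn n0) ler_pXn2r ?nnegrE ?powR_ge0 //.
Qed.

(** Blocks of length [n] are split off, each costing a factor [y ^+ n], until the remaining length
    lies between 1 and [n]; [C] absorbs that remainder. *)
Lemma submul_geometric n y : (0 < n)%N -> 0 < y -> a n <= y ^+ n ->
  exists2 C, 1 <= C & forall m, (0 < m)%N -> a m <= C * y ^+ m.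
Proof.
move=> n0 y0 any.
(* The absolute values keep the summand [r = 0] nonnegative, the sign of [a 0] being unknown. *)
pose C := 1 + \sum_(r < n.+1) `|a r| / y ^+ r.
have C0 : 1 <= C.
  by rewrite lerDl sumr_ge0 // => i _; rewrite divr_ge0 // exprn_ge0 // ltW.
exists C => // m; have [k] := ubnP m; elim: k m => // k IH m mk m0.
have [mn|nm] := leqP m n.
  rewrite -ler_pdivrMr ?exprn_gt0 // /C (bigD1 (Ordinal (mn : (m < n.+1)%N))) //=.
  rewrite addrCA; apply: le_trans (_ : `|a m| / y ^+ m <= _).
    by rewrite ler_pM2r ?invr_gt0 ?exprn_gt0 // ler_norm.
  rewrite lerDl addr_ge0 // sumr_ge0 // => i _.
  by rewrite divr_ge0 // exprn_ge0 // ltW.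
rewrite -(subnKC (ltnW nm)); apply: le_trans (a_submul n0 _) _.
  by rewrite subn_gt0.
rewrite exprD mulrCA ler_pM ?a_ge0 ?subn_gt0 //.
by apply: IH; rewrite ?subn_gt0 //; lia.
Qed.

Let has_inf_root : has_inf (root @` [set n | (0 < n)%N]).
Proof.
split; first by exists (root 1), 1%N.
by exists 0 => _ [n _ <-]; exact: powR_ge0.
Qed.

Let L_ge0 : 0 <= L.
Proof.
apply: lb_le_inf; first by case: has_inf_root.
by move=> _ [n _ <-]; exact: powR_ge0.
Qed.

Let L_le n : (0 < n)%N -> L <= root n.
Proof. by move=> n0; apply: ge_inf; [case: has_inf_root | exists n]. Qed.

Let geometric_above y : L < y ->
  exists2 C, 1 <= C & forall m, (0 < m)%N -> a m <= C * y ^+ m.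
Proof.
move=> Ly; have y0 := le_lt_trans L_ge0 Ly.
have [_ [n /= n0 <-] ny] := inf_lt (has_inf_root.1) Ly.
by apply: (@submul_geometric n) => //; rewrite -root_le // ltW.
Qed.

Lemma fekete : root @ \oo --> L.
Proof.
apply/cvgrPdist_le => e e0.
pose y := L + e / 2.
have ey : 0 < e / 2 by rewrite divr_gt0.
have y0 : 0 < y by rewrite ltr_wpDl.
have [C C1 aC] : exists2 C, 1 <= C & forall m, (0 < m)%N -> a m <= C * y ^+ m.
  by apply: geometric_above; rewrite ltrDl.
pose h := e / 2 / y.
have h0 : 0 < h by rewrite divr_gt0.
(* [M] exceeds [C / h], so Bernoulli's inequality gives [C <= (1 + h) ^+ m] for [m > M], while
   [y * (1 + h) = L + e]. *)
have := archi_boundP (divr_ge0 (le_trans ler01 C1) (ltW h0)).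
set M := Num.bound _ => CM.
exists M.+1 => // m /= Mm; have m0 : (0 < m)%N by rewrite (leq_trans _ Mm).
rewrite distrC ger0_norm ?subr_ge0 ?L_le // lerBlDl.
have -> : L + e = y * (1 + h).
  by rewrite /h mulrDr mulr1 mulrCA divff ?gt_eqF // mulr1 /y -addrA -splitr.
rewrite root_le //; last by rewrite mulr_ge0 ?addr_ge0 // ltW.
apply: le_trans (aC m m0) _; rewrite exprMn mulrC ler_pM2l ?exprn_gt0 //.
apply: le_trans (bernoulli_ge _ (ltW h0)); apply: le_trans (_ : m%:R * h <= _).
  rewrite -ler_pdivrMr //; apply: le_trans (ltW CM) _.
  by rewrite ler_nat ltnW.
by rewrite lerDr.
Qed.

Lemma root_lim_ge0 : 0 <= lim (root @ \oo).
Proof. by rewrite (cvg_lim _ fekete). Qed.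

Lemma root_lim_le n : (0 < n)%N -> lim (root @ \oo) ^+ n <= a n.
Proof.
move=> n0; rewrite (cvg_lim _ fekete) // -(root_expn n0).
by rewrite lerXn2r ?nnegrE ?powR_ge0 // L_le.
Qed.

Lemma root_lim_geometric y : lim (root @ \oo) < y ->
  exists2 C, 1 <= C & forall m, (0 < m)%N -> a m <= C * y ^+ m.
Proof. by rewrite (cvg_lim _ fekete) //; exact: geometric_above. Qed.

End Fekete.
End Growth.

(** * Monomial vectors and tensor powers of points of the closure *)

Section Span.
Variables (K : fieldType) (V : vectType K).
Local Notation d := (\dim {:V}).

(** A longest sequence of points of [A] with free image works: a point of [A] whose image lies
    outside the span would extend it. *)
Lemma finite_spanning_seq (W : vectType K) (phi : V -> W) (A : set V) :
  exists s : seq V, [/\ (size s <= \dim {:W})%N, {in s, forall x, A x} &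
    forall v, A v -> phi v \in <<map phi s>>%VS].
Proof.
pose P k := `[< exists s : seq V,
  [/\ size s = k, {in s, forall x, A x} & free (map phi s)] >].
have P0 : exists k, P k.
  by exists 0%N; apply/asboolP; exists [::]; split=> //=; exact: nil_free.
have Pmax k : P k -> (k <= \dim {:W})%N.
  case/asboolP=> s [<- _ /eqP fs].
  by rewrite -(size_map phi) -fs dimvS ?subvf.
case: (ex_maxnP P0 Pmax) => k /asboolP[s [sk sA fs]] kmax.
exists s; split=> // [|v Av]; first by rewrite sk Pmax //; apply/asboolP; exists s.
apply: contraT => vs; suff /kmax : P k.+1 by rewrite ltnn.
apply/asboolP; exists (v :: s); split=> /=; rewrite ?sk ?free_cons ?vs //.
by move=> x; rewrite inE => /predU1P[->|/sA].
Qed.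

(** Bounding each exponent separately, not the total degree, makes the count exactly [n.+1 ^ d]. *)
Definition exponents n := {ffun 'I_d -> 'I_n.+1}.

Definition monomials n (v : V) : 'rV[K]_#|exponents n| :=
  \row_m \prod_(j < d) vcoord v j ^+ (enum_val m : exponents n) j.

(** A linear form in the monomials is the evaluation of a polynomial [p] with coefficients [c]. *)
Lemma zariski_closure_linear n (A : set V) (T : V)
    (c : 'cV[K]_#|exponents n|) :
  zariski_closure A T -> (forall v, A v -> monomials n v *m c = 0) ->
  monomials n T *m c = 0.
Proof.
pose p : mpoly.mpoly d K := \sum_m c m 0 *:
  \prod_(j < d) mpoly.mpolyX K (mpoly.mnm1 j) ^+ (enum_val m : exponents n) j.
have pE v : monomials n v *m c = (mpoly.meval (vcoord v) p)%:M.
  apply/rowP => i; rewrite ord1 !mxE mulr1n rmorph_sum; apply: eq_bigr => m _.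
  rewrite /= mpoly.mevalZ rmorph_prod mulrC mxE; congr (_ * _).
  by apply: eq_bigr => j _; rewrite rmorphXn /= mpoly.mevalXU.
move=> clT cA; rewrite pE clT ?raddf0 // => w /cA.
by rewrite pE => /rowP/(_ 0); rewrite !mxE mulr1n.
Qed.

(** The span is cut out by the columns of [1%:M - proj], each a linear equation on monomials that
    holds on [A] and hence at [T]. *)
Lemma monomials_closure_span n (A : set V) (T : V) (s : seq V) :
  zariski_closure A T ->
  (forall v, A v -> monomials n v \in <<map (monomials n) s>>%VS) ->
  monomials n T \in <<map (monomials n) s>>%VS.
Proof.
move=> clT As; set U := <<_>>%VS in As *.
pose proj := lin1_mx (projv U).
have inU v : (monomials n v \in U) = (monomials n v *m (1%:M - proj) == 0).
  rewrite mulmxBr mulmx1 mul_rV_lin1 subr_eq0 /=.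
  by apply/idP/eqP => [/projv_id ->|e] //; rewrite e memv_proj.
rewrite inU; apply/eqP/matrixP => i j; rewrite ord1.
pose c := col j (1%:M - proj).
have cE v : monomials n v *m c = col j (monomials n v *m (1%:M - proj)).
  by rewrite /c !colE mulmxA.
have : monomials n T *m c = 0.
  apply: zariski_closure_linear clT _ => v /As.
  by rewrite inU cE => /eqP ->; rewrite !colE mul0mx.
by rewrite cE => /colP/(_ 0); rewrite !mxE.
Qed.

Definition letter_count n (f : {ffun 'I_n -> 'I_d}) : exponents n :=
  [ffun j => inord #|[pred i | f i == j]|].

(** A coordinate of a tensor power depends only on how often each basis index occurs in [f]. These
    counts are at most [n], so [inord] loses nothing. *)
Lemma texp_monomials n v f :
  texp v n f = monomials n v 0 (enum_rank (letter_count f)).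
Proof.
rewrite ffunE mxE enum_rankK (partition_big f xpredT) //=.
apply: eq_bigr => j _; rewrite ffunE inordK.
  by rewrite (eq_bigr (fun=> vcoord v j)) ?prodr_const // => i /eqP ->.
by rewrite ltnS -[X in (_ <= X)%N](card_ord n) max_card.
Qed.

(** The entry at exponent zero is 1. Hence the combination found below is nonempty, even for
    [T = 0]. *)
Lemma monomials_neq0 n v : monomials n v != 0.
Proof.
apply/eqP => /rowP/(_ (enum_rank [ffun=> ord0])).
rewrite !mxE enum_rankK big1 => [/eqP|j _]; first by rewrite oner_eq0.
by rewrite ffunE.
Qed.

(** Coordinates of [n]-th tensor powers are entries of [monomials n], so a linear relation between
    monomial vectors carries over. *)
Lemma zariski_closure_texp n (A : set V) (T : V) : zariski_closure A T ->
  exists s : seq (K * V), [/\ (0 < size s <= n.+1 ^ d)%N,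
    {in s, forall p, A p.2} & texp T n = \sum_(p <- s) p.1 *: texp p.2 n].
Proof.
move=> clT; have [s [ss sA As]] := finite_spanning_seq (monomials n) A.
have [c Tc] : exists c : 'I_(size s) -> K,
    monomials n T = \sum_i c i *: monomials n s`_i.
  have := monomials_closure_span clT As.
  rewrite -[map _ s]/(tval (map_tuple (monomials n) (in_tuple s))).
  move=> /coord_span Tc; eexists; rewrite {1}Tc; apply: eq_bigr => i _.
  by rewrite /= (nth_map 0).
exists [seq (c i, s`_i) | i <- enum 'I_(size s)]; split.
- rewrite size_map size_enum_ord; apply/andP; split.
    rewrite lt0n; apply: contra (monomials_neq0 n T) => /eqP s0.
    by rewrite Tc big1 // => i; have := ltn_ord i; rewrite [X in (_ < X)%N]s0.
  rewrite (leq_trans ss) // dimvf /dim /= mul1n card_ffun !card_ord //.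
- by move=> _ /mapP[i _ ->] /=; apply/sA/mem_nth.
rewrite big_map big_enum; apply/ffunP => f.
rewrite texp_monomials Tc summxE sum_ffunE; apply: eq_bigr => i _.
by rewrite [RHS]ffunE texp_monomials mxE.
Qed.
End Span.

(** * Words of vectors as pure tensors *)

Section Words.
Variables (K : fieldType) (V : vectType K).

Definition word_tensor (s : seq V) : htensor V :=
  Tagged (tpow V) (tpure (fun i : 'I_(size s) => s`_i)).

(** Degrees such as [size (s ++ t)] and [size s + size t] agree only up to a proof, so entries are
    compared through the values of their indices. *)
Lemma eq_tagged_tpure m n (v : 'I_m -> V) (w : 'I_n -> V) :
  m = n -> (forall i j, val i = val j -> v i = w j) ->
  Tagged (tpow V) (tpure v) = Tagged (tpow V) (tpure w) :> htensor V.
Proof.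
move=> mn; move: w; rewrite -mn => w vw.
by congr (Tagged _ (tpure _)); apply/funext => i; exact: vw.
Qed.

Lemma word_tensor_nseq n v :
  word_tensor (nseq n v) = Tagged (tpow V) (texp v n).
Proof.
apply: eq_tagged_tpure; first exact: size_nseq.
by move=> i j _; rewrite nth_nseq (leq_trans (ltn_ord i)) ?size_nseq.
Qed.

Lemma word_tensor_cat s t :
  word_tensor (s ++ t) = hmul (word_tensor s) (word_tensor t).
Proof.
rewrite /hmul /= tmul_tpure; apply: eq_tagged_tpure; first exact: size_cat.
move=> i j ij; rewrite /= in ij; rewrite nth_cat ij.
by case: splitP => k -> //; rewrite addKn.
Qed.

Lemma word_tensor_prod l (v : 'I_l -> V) :
  tensor_prod (fun j : 'I_l => texp (v j) 1) = word_tensor (codom v).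
Proof.
rewrite /tensor_prod codomE [index_enum _]unlock -enumT.
elim: (enum 'I_l) => [|j r IH] /=.
  rewrite big_nil /hone /word_tensor; congr (Tagged _ _).
  by apply/ffunP => f; rewrite !ffunE big_ord0.
by rewrite big_cons IH -word_tensor_nseq -word_tensor_cat.
Qed.

End Words.

(** * Admissible functionals on words and bounds on the regularization *)

Section Functional.
Variables (R : realType) (K : fieldType) (V : vectType K).
Variables (F : forall n, tpow V n -> R) (admF : admissible F).

Definition on_htensor (X : htensor V) : R := F (tagged X).

Local Notation G s := (on_htensor (word_tensor s)).

Lemma word_texp n v : G (nseq n v) = F (texp v n).
Proof. by rewrite word_tensor_nseq. Qed.

Lemma word_ge0 s : s != [::] -> 0 <= G s.
Proof. by rewrite -size_eq0 -lt0n => s0; apply: adm_ge0. Qed.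

Lemma word_submul s t : s != [::] -> t != [::] -> G (s ++ t) <= G s * G t.
Proof.
rewrite -!size_eq0 -!lt0n word_tensor_cat => s0 t0; exact: adm_submul.
Qed.

Lemma texp_submul v m n : (0 < m)%N -> (0 < n)%N ->
  F (texp v (m + n)) <= F (texp v m) * F (texp v n).
Proof.
by move=> m0 n0; rewrite -!word_texp nseqD word_submul // -size_eq0 size_nseq -lt0n.
Qed.

(** Splitting a word into factors of degree one brings it into the form to which [adm_perm]
    applies. *)
Lemma word_perm s t : perm_eq s t -> G s = G t.
Proof.
have [->|t0] := eqVneq t [::]; first by move/perm_nilP ->.
rewrite -[X in perm_eq _ X]/(tval (in_tuple t)) => /tuple_permP[p ->].
have tE : word_tensor t = tensor_prod (fun j => texp (tnth (in_tuple t) j) 1).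
  by rewrite word_tensor_prod codomE map_tnth_enum.
have -> : [tuple tnth (in_tuple t) (p i) | i < size t] =
    codom (fun i => tnth (in_tuple t) (p i)) :> seq V.
  by rewrite codomE.
rewrite -word_tensor_prod tE; apply: (adm_perm admF) => //.
by rewrite lt0n size_eq0.
Qed.

(* The case [c = 0] needs a factor 2, as [F] may be nonzero at [0]. *)
Lemma adm_scale2 n (c : K) (X : tpow V n) : (0 < n)%N ->
  F (c *: X) <= 2 * F X.
Proof.
move=> n0; have FX := adm_ge0 admF X n0.
have [->|c0] := eqVneq c 0; last first.
  by rewrite (adm_scale admF) // ler_peMl // ler1n.
rewrite scale0r -(subrr X) (le_trans (adm_subadd admF _ _ n0)) //.
by rewrite -scaleN1r (adm_scale admF) ?oppr_eq0 ?oner_eq0 // mulr2n mulrDl mul1r.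
Qed.

Lemma adm_lincomb n (I : eqType) (r : seq I) (c : I -> K) (X : I -> tpow V n) :
  (0 < n)%N -> r != [::] ->
  F (\sum_(i <- r) c i *: X i) <= 2 * \sum_(i <- r) F (X i).
Proof.
move=> n0; elim: r => // i [|j r] IH _.
  by rewrite !big_seq1 adm_scale2.
rewrite big_cons [in leRHS]big_cons mulrDr.
by apply: le_trans (adm_subadd admF _ _ n0) _; rewrite lerD ?adm_scale2 ?IH.
Qed.

(** [tmul] is linear in its left factor, so the leading block is expanded while [t] is carried
    along. *)
Lemma word_lincomb n (T : V) (s : seq (K * V)) (t : seq V) :
  (0 < n)%N -> s != [::] -> texp T n = \sum_(p <- s) p.1 *: texp p.2 n ->
  G (nseq n T ++ t) <= 2 * \sum_(p <- s) G (nseq n p.2 ++ t).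
Proof.
move=> n0 s0 TE.
have GE v : G (nseq n v ++ t) = F (tmul (texp v n) (tagged (word_tensor t))).
  by rewrite word_tensor_cat word_tensor_nseq.
rewrite GE TE; under [in leRHS]eq_bigr do rewrite GE.
have -> : tmul (\sum_(p <- s) p.1 *: texp p.2 n) (tagged (word_tensor t)) =
    \sum_(p <- s) p.1 *: tmul (texp p.2 n) (tagged (word_tensor t)).
  apply/ffunP => f; rewrite !(sum_ffunE, ffunE) mulr_suml.
  apply: eq_bigr => p _; rewrite !ffunE; exact: esym (mulrA _ _ _).
by apply: adm_lincomb; rewrite // addn_gt0 n0.
Qed.

Lemma regularization_ge0 v : 0 <= regularization F v.
Proof.
by apply: root_lim_ge0 => [n|m n]; [exact: adm_ge0 | exact: texp_submul].
Qed.

Lemma regularization_le v n :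
  (0 < n)%N -> regularization F v ^+ n <= F (texp v n).
Proof.
by apply: root_lim_le => [m|m k]; [exact: adm_ge0 | exact: texp_submul].
Qed.

Lemma regularization_geometric v y : regularization F v < y ->
  exists2 C, 1 <= C & forall m, (0 < m)%N -> F (texp v m) <= C * y ^+ m.
Proof.
by apply: root_lim_geometric => [m|m k]; [exact: adm_ge0 | exact: texp_submul].
Qed.

(* Sorting the letters of a word turns it into a product of powers of the
   finitely many vectors in [L]. *)
Lemma word_geometric (L : seq V) y : 0 < y ->
  {in L, forall v, regularization F v < y} ->
  exists2 C, 1 <= C & forall s, s != [::] -> {subset s <= L} ->
    G s <= C * y ^+ size s.
Proof.
move=> y0; elim: L => [_|v L IH Ly].
  by exists 1 => // -[//|x s] _ /(_ x); rewrite inE eqxx => /(_ isT).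
have [x xL|C C1 GC] := IH; first by apply: Ly; rewrite inE xL orbT.
have [D D1 FD] := regularization_geometric (Ly v (mem_head _ _)).
have C0 : 0 <= C := le_trans ler01 C1.
have D0 : 0 <= D := le_trans ler01 D1.
exists (D * C) => [|s s0 sL]; first by rewrite mulr_ege1.
have y_ge0 n : 0 <= y ^+ n by rewrite exprn_ge0 // ltW.
rewrite -(word_perm (permEl (perm_filterC (pred1 v) s))).
rewrite -(perm_size (permEl (perm_filterC (pred1 v) s))) size_cat.
have -> : [seq x <- s | pred1 v x] = nseq (size [seq x <- s | pred1 v x]) v.
  exact/all_pred1P/filter_all.
set n := size _; set t := [seq x <- s | _]; rewrite size_nseq.
have tL : {subset t <= L}.
  move=> x; rewrite mem_filter /= => /andP[xv /sL].
  by rewrite inE (negPf xv).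
have Gn : (0 < n)%N -> G (nseq n v) <= D * y ^+ n by rewrite word_texp; exact: FD.
(* Submultiplicativity needs positive degrees, so empty parts are treated apart; there [1 <= C] or
   [1 <= D] supplies the missing constant. *)
have [n0|n0] := posnP n; have [t0|t0] := eqVneq t [::].
- move: s0; rewrite -size_eq0 -(perm_size (permEl (perm_filterC (pred1 v) s))).
  by rewrite size_cat -/n n0 -/t t0.
- by rewrite n0 /= add0n (le_trans (GC t t0 tL)) // ler_wpM2r // ler_peMl.
- by rewrite t0 cats0 addn0 (le_trans (Gn n0)) // ler_wpM2r // ler_peMr.
apply: le_trans (word_submul _ t0) _; first by rewrite -size_eq0 size_nseq -lt0n.
rewrite exprD mulrACA ler_pM ?Gn ?GC // word_ge0 //.
by rewrite -size_eq0 size_nseq -lt0n.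
Qed.

Lemma regularization_span_le n (T : V) (s : seq (K * V)) y :
  (0 < n)%N -> s != [::] -> texp T n = \sum_(p <- s) p.1 *: texp p.2 n ->
  0 < y -> {in s, forall p, regularization F p.2 < y} ->
  regularization F T ^+ n <= (2 * size s)%:R * y ^+ n.
Proof.
move=> n0 s0 TE y0 sy.
have [x /mapP[p ps ->]|C C1 GC] := @word_geometric (map snd s) y y0; first exact: sy.
set q : R := (2 * size s)%:R.
have qE x : q * x = 2 * \sum_(p <- s) x.
  by rewrite /q natrM -mulrA big_const_seq count_predT iter_addr_0 (mulr_natl x).
(* The suffix [t] collects the blocks already expanded: [perm_catCA] moves each new block behind the
   remaining copies of [T]. *)
have step k t : (0 < k + size t)%N -> {subset t <= map snd s} ->
    G (nseq (n * k) T ++ t) <= q ^+ k * (C * y ^+ (n * k + size t)).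
  elim: k t => [|k IH] t kt ts.
    by rewrite muln0 expr0 mul1r add0n GC // -size_eq0 -lt0n.
  rewrite mulnS nseqD -catA.
  apply: le_trans (word_lincomb _ n0 s0 TE) _.
  rewrite exprS -mulrA qE ler_pM2l // big_seq [leRHS]big_seq.
  apply: ler_sum => p ps.
  rewrite (word_perm (permEl (perm_catCA _ _ _))).
  apply: le_trans (IH _ _ _) _.
  - by rewrite size_cat size_nseq addnCA ltn_addr.
  - move=> x; rewrite mem_cat mem_nseq => /orP[/andP[_ /eqP ->]|/ts//].
    exact: map_f.
  - by rewrite size_cat size_nseq addnA [(n * k + n)%N]addnC.
have q0 : 0 < q by rewrite ltr0n muln_gt0 /= lt0n size_eq0.
(* The exponent is now [k], with [n] fixed; degree 0 suffices because only the constant [C] must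
   disappear. *)
apply: (@le_of_exp_le _ _ _ C 0).
- by rewrite exprn_ge0 // regularization_ge0.
- by rewrite mulr_gt0 ?exprn_gt0.
move=> k k0; rewrite expr0 mulr1 -exprM.
apply: le_trans (regularization_le _ _) _; first by rewrite muln_gt0 n0.
rewrite -word_texp -[nseq _ _]cats0 (le_trans (step _ _ _ _)) ?addn0 //.
by rewrite exprMn -exprM mulrCA.
Qed.

Lemma regularization_closure_le (A : set V) (T : V) y :
  zariski_closure A T -> 0 < y -> (forall v, A v -> regularization F v < y) ->
  regularization F T <= y.
Proof.
move=> clT y0 Ay.
(* The number of terms is at most [n.+1 ^ \dim {:V}], and the remaining 2 comes from scaling. *)
apply: (@le_of_exp_le _ _ _ 2 (\dim {:V})) => // [|n n0].
  exact: regularization_ge0.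
have [s [/andP[s0 sn] sA TE]] := zariski_closure_texp n clT.
have sy : {in s, forall p, regularization F p.2 < y} by move=> p /sA/Ay.
apply: le_trans (regularization_span_le n0 _ TE y0 sy) _.
  by rewrite -size_eq0 -lt0n.
rewrite ler_wpM2r ?exprn_ge0 ?(ltW y0) // natrM ler_pM2l // -natrX ler_nat.
exact: sn.
Qed.

End Functional.

(** * Comparison of the two suprema *)

Lemma zariski_closure_neq0 (K : fieldType) (V : vectType K) (A : set V) T :
  zariski_closure A T -> A !=set0.
Proof.
move=> /(zariski_closure_texp 1)[[|p s] [// _ sA _]].
by exists p.2; apply: sA; exact: mem_head.
Qed.

Theorem theorem2p2 (R : realType) (K : fieldType) (V : vectType K)
    (F : forall n : nat, tpow V n -> R) (A : set V) :
  admissible F ->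
  regularization_sup F (zariski_closure A) = regularization_sup F A.
Proof.
move=> admF; apply/eqP; rewrite eq_le; apply/andP; split; last first.
  apply: le_ereal_sup => _ [v Av <-]; exists v => //.
  by move=> p pA; exact: pA.
apply: ge_ereal_sup => _ [T clT <-].
(* The point [S] excludes the supremum [-oo] and makes a finite supremum nonnegative. *)
have [S AS] := zariski_closure_neq0 clT.
have supA v : A v -> ((regularization F v)%:E <= regularization_sup F A)%E.
  by move=> Av; apply: ereal_sup_ubound; exists v.
case E : (regularization_sup F A) supA => [x| |] supA; last 2 first.
- by rewrite leey.
- by have := supA S AS; rewrite leeNy_eq.
(* The slack [e] makes [x + e] positive and strictly above every regularization on [A]. *)
rewrite lee_fin; apply/ler_addgt0Pr => e e0.
apply: (regularization_closure_le admF clT).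
  have := supA S AS; rewrite lee_fin => /(le_trans (regularization_ge0 admF S)).
  by move=> x0; rewrite ltr_wpDl.
by move=> v /supA; rewrite lee_fin => /le_lt_trans -> //; rewrite ltrDl.
Qed.
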